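(* In $\mathbb{Z}[[x,y]]$, $$W(x,y):=\sum_{t,k=0}^\infty w(t,k)y^tx^k=\frac{c(x)}{1-y\,c(x)}.$$
   Context: A Temperley-Lieb diagram $t\to n$ is a planar non-crossing perfect matching (up to isotopy) of $t$ points on a bottom line and $n$ points on a top line, drawn in the strip between the lines; it is monic if every bottom point is joined to a top point. The cell module $W_t(n)$ of the Temperley-Lieb algebra $TL_n(q)$ has basis the monic diagrams $t\to n$. For $t,k\ge0$, $w(t,k):=\dim W_t(t+2k)$, the number of monic diagrams $t\to t+2k$ (with $w(0,0)=1$, the empty diagram). Put $c(n):=w(0,n)$ for $n\ge0$, so $c(0)=1$, and $c(x):=\sum_{n=0}^\infty c(n)x^n$. *)

(* Defs.v *)
From HB Require Import structures.
From mathcomp Require Import all_boot all_order all_algebra.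
From mathcomp Require Import boolp.

Set Implicit Arguments.
Unset Strict Implicit.
Unset Printing Implicit Defensive.

Import GRing.Theory.
Local Open Scope ring_scope.

Record fps (R : Type) : Type := Fps { coef_fps :> nat -> R }.

Notation "{ 'fps' R }" := (fps R) (format "{ 'fps'  R }") : type_scope.

Lemma fpsP (R : Type) (f g : {fps R}) : (forall n, f n = g n) <-> f = g.
Proof.
split=> [|->//]; case: f g => [f] [g] /= e; congr Fps; exact: functional_extensionality_dep.
Qed.

HB.instance Definition _ (R : Type) := gen_eqMixin {fps R}.
HB.instance Definition _ (R : Type) := gen_choiceMixin {fps R}.

Section Zmodule.
Variable R : zmodType.
Implicit Types f g h : {fps R}.

Definition fps_zero : {fps R} := Fps (fun=> 0).
Definition fps_opp f : {fps R} := Fps (fun n => - f n).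
Definition fps_add f g : {fps R} := Fps (fun n => f n + g n).

Fact fps_addA : associative fps_add.
Proof. by move=> f g h; apply/fpsP=> n /=; rewrite addrA. Qed.
Fact fps_addC : commutative fps_add.
Proof. by move=> f g; apply/fpsP=> n /=; rewrite addrC. Qed.
Fact fps_add0 : left_id fps_zero fps_add.
Proof. by move=> f; apply/fpsP=> n /=; rewrite add0r. Qed.
Fact fps_addN : left_inverse fps_zero fps_opp fps_add.
Proof. by move=> f; apply/fpsP=> n /=; rewrite addNr. Qed.

HB.instance Definition _ :=
  GRing.isZmodule.Build {fps R} fps_addA fps_addC fps_add0 fps_addN.

Lemma coef_fps0 n : (0 : {fps R}) n = 0. Proof. by []. Qed.
Lemma coef_fpsD f g n : (f + g) n = f n + g n. Proof. by []. Qed.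
Lemma coef_fpsN f n : (- f) n = - f n. Proof. by []. Qed.
Lemma coef_fpsB f g n : (f - g) n = f n - g n. Proof. by []. Qed.

End Zmodule.

Section ComNzRing.
Variable R : comNzRingType.
Implicit Types f g h : {fps R}.

Definition fpsC (a : R) : {fps R} := Fps (fun n => if n == 0%N then a else 0).
Definition fpsX : {fps R} := Fps (fun n => (n == 1%N)%:R).

Definition fps_mul f g : {fps R} :=
  Fps (fun n => \sum_(i < n.+1) f i * g (n - i)%N).

Let trunc n f : {poly R} := \poly_(i < n) f i.

Let coef_mul f g m n :
  (n < m)%N -> fps_mul f g n = (trunc m f * trunc m g)`_n.
Proof.
move=> lt_nm; rewrite coefM /=; apply: eq_bigr => i _.
by rewrite !coef_poly !(leq_ltn_trans _ lt_nm) ?leq_subr // -ltnS.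
Qed.

Fact fps_mulA : associative fps_mul.
Proof.
move=> f g h; apply/fpsP=> n.
pose t k := trunc n.+1 k.
have -> : fps_mul f (fps_mul g h) n = (t f * (t g * t h))`_n.
  rewrite coefM; apply: eq_bigr => i _.
  rewrite (@coef_mul g h n.+1) ?ltnS ?leq_subr //.
  by rewrite coef_poly ltn_ord.
have -> : fps_mul (fps_mul f g) h n = (t f * t g * t h)`_n.
  rewrite coefM; apply: eq_bigr => i _.
  rewrite (@coef_mul f g n.+1) // [in RHS]/t [(trunc _ h)`_ _]coef_poly.
  by rewrite ltnS leq_subr.
by rewrite mulrA.
Qed.

Fact fps_mulC : commutative fps_mul.
Proof. by move=> f g; apply/fpsP=> n; rewrite !(coef_mul _ _ (ltnSn n)) mulrC. Qed.

Fact fps_mul1 : left_id (fpsC 1) fps_mul.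
Proof.
move=> f; apply/fpsP=> n /=; rewrite big_ord_recl /= mul1r subn0 big1 ?addr0 //.
by move=> i _; rewrite mul0r.
Qed.

Fact fps_mulDl : left_distributive fps_mul (@fps_add R).
Proof.
move=> f g h; apply/fpsP=> n /=; rewrite -big_split /=.
by apply: eq_bigr => i _; rewrite mulrDl.
Qed.

Fact fps_1neq0 : fpsC 1 != 0.
Proof. by apply/eqP => /fpsP/(_ 0%N)/eqP /=; rewrite oner_eq0. Qed.

HB.instance Definition _ := GRing.Zmodule_isComNzRing.Build {fps R}
  fps_mulA fps_mulC fps_mul1 fps_mulDl fps_1neq0.

Lemma coef_fps1 n : (1 : {fps R}) n = (n == 0%N)%:R.
Proof. by case: n. Qed.
Lemma coef_fpsM f g n : (f * g) n = \sum_(i < n.+1) f i * g (n - i)%N.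
Proof. by []. Qed.
Lemma coef_fpsXM f n : (fpsX * f) n = if n is m.+1 then f m else 0.
Proof.
case: n => [|n]; rewrite coef_fpsM big_ord_recl /= mul0r add0r ?big_ord0 //.
rewrite big_ord_recl /= mul1r big1 ?addr0 ?subSS ?subn0 //.
by move=> i _; rewrite mul0r.
Qed.

End ComNzRing.

Section ComUnitRing.
Variable R : comUnitRingType.
Implicit Types f g : {fps R}.

Definition fps_unit : {pred {fps R}} := fun f => f 0%N \is a GRing.unit.

(* The first n coefficients of the inverse g of f, obtained by solving
   f 0 * g m + f 1 * g (m - 1) + ... + f m * g 0 = (m == 0)%:R for g m. *)
Fixpoint fps_inv_seq f n : seq R :=
  if n is m.+1 then
    let s := fps_inv_seq f m in
    rcons s ((f 0%N)^-1 * ((m == 0%N)%:R - \sum_(i < m) s`_i * f (m - i)%N))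
  else [::].

Definition fps_inv f : {fps R} :=
  if f \in fps_unit then Fps (fun n => (fps_inv_seq f n.+1)`_n) else f.

Let size_inv_seq f n : size (fps_inv_seq f n) = n.
Proof. by elim: n => //= n IHn; rewrite size_rcons IHn. Qed.

Let nth_inv_seq f n i :
  (i < n)%N -> (fps_inv_seq f n)`_i = (fps_inv_seq f i.+1)`_i.
Proof.
elim: n => // n IHn; rewrite ltnS leq_eqVlt => /predU1P[-> //|lt_in].
by rewrite -IHn //= nth_rcons size_inv_seq lt_in.
Qed.

Fact fps_mulV : {in fps_unit, left_inverse 1 fps_inv *%R}.
Proof.
move=> f Uf; rewrite /fps_inv Uf; apply/fpsP=> n.
rewrite coef_fpsM coef_fps1 big_ord_recr subnn.
set S := \sum_(i < n) _.
have -> : S = \sum_(i < n) (fps_inv_seq f n)`_i * f (n - i)%N.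
  by apply: eq_bigr => i _; rewrite nth_inv_seq.
rewrite /= nth_rcons size_inv_seq ltnn eqxx mulrC mulVKr //.
by rewrite addrC subrK.
Qed.

Fact fps_unitPl f g : g * f = 1 -> fps_unit f.
Proof.
move=> /fpsP/(_ 0%N); rewrite coef_fpsM big_ord1 /= => gf1.
by apply/unitrPr; exists (g 0%N); rewrite mulrC.
Qed.

Fact fps_invr_out : {in [predC fps_unit], fps_inv =1 id}.
Proof. by move=> f; rewrite inE /= /fps_inv => /negPf->. Qed.

HB.instance Definition _ := GRing.ComNzRing_hasMulInverse.Build {fps R}
  fps_mulV fps_unitPl fps_invr_out.

Lemma fps_unitE f : (f \is a GRing.unit) = (f 0%N \is a GRing.unit).
Proof. by []. Qed.

End ComUnitRing.

(* inl i is the i-th bottom point and inr j the j-th top point, both from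
   left to right. *)
Definition point (t n : nat) : finType := ('I_t + 'I_n)%type.

(* Position of a point on the boundary of the strip, read along the bottom
   line from left to right and then along the top line from right to left. *)
Definition pos (t n : nat) (p : point t n) : nat :=
  match p with inl i => i | inr j => (t + rev_ord j)%N end.

(* A perfect matching is encoded by the map sending each point to its partner. *)
Definition perfect_matching (t n : nat) (d : {ffun point t n -> point t n}) :=
  [forall p, (d p != p) && (d (d p) == p)].

(* Isotopy classes of planar diagrams correspond to non-crossing matchings: a
   matching can be drawn in the strip without crossings iff no two of
   its pairs {p, d p} and {q, d q} alternate along the boundary. *)
Definition non_crossing (t n : nat) (d : {ffun point t n -> point t n}) :=
  [forall p, forall q,
     ~~ [&& pos p < pos q, pos q < pos (d p) & pos (d p) < pos (d q)]%N].

Definition TL_diagram (t n : nat) : finType :=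
  {d : {ffun point t n -> point t n} | perfect_matching d && non_crossing d}.

Definition monic (t n : nat) (d : TL_diagram t n) :=
  [forall i : 'I_t, exists j : 'I_n, val d (inl i) == inr j].

Definition w (t k : nat) : nat := #|[set d : TL_diagram t (t + 2 * k)%N | monic d]|.

Definition c (n : nat) : nat := w 0 n.

(* Z[[x, y]] is encoded as Z[[x]][[y]]: the coefficient of y^t x^k in F is F t k. *)

Definition ZZxy : comUnitRingType := {fps {fps int}}.

Definition y : ZZxy := fpsX {fps int}.

Definition c_series : {fps int} := Fps (fun n => (c n)%:Z).

Definition cx : ZZxy := fpsC c_series.

Definition Wxy : ZZxy := Fps (fun t => Fps (fun k => (w t k)%:Z)).

Fact denominator_unit : 1 - y * cx \is a GRing.unit.
Proof.
by rewrite fps_unitE coef_fpsB coef_fpsXM /= subr0 unitr1.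
Qed.

(* Main.v *)
Require Import Defs.
From mathcomp Require Import all_boot all_order all_algebra.
From mathcomp Require Import zify.
Local Open Scope ring_scope.

Set Implicit Arguments.
Unset Strict Implicit.
Unset Printing Implicit Defensive.

Import GRing.Theory.

(** Cutting a monic diagram with [t + 1 + a] bottom points along the strand
    that leaves the bottom point [t] splits it into a monic diagram with [t]
    bottom points, to the left of the strand, and one with [a] bottom points, to
    its right; the strand and the two parts can be chosen freely.  Hence
    [w (t + a).+1 k] is the convolution of the sequences [w t] and [w a]
    ([w_convolution]).  For [a = 0] this says that the coefficient [W_t(x)] of
    [y ^ t] satisfies [W_{t+1} = W_t c], so that [W (1 - y c) = c], which is the
    theorem.

    The convolution is derived from recurrences, so that diagrams are modified
    by only one arc at a time.  Reading the boundary of the strip as a line with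
    positions [0, ..., N - 1] turns a monic diagram into a non-crossing matching
    in which none of the first [t] positions has its partner among the first
    [t] (the set [links N t]).  Look at position [t], the first one that comes
    from the top line.  Either its partner is further right, and then it
    may be counted as one more bottom point: a matching in [links N t.+1].  Or
    its partner is to its left, and then, as nothing crosses this arc, the partner
    is the neighbour [t - 1]; removing the arc leaves a matching in
    [links (N - 2) (t - 1)].  Thus ([card_linksS])
      [#|links N.+2 s.+1| = #|links N.+2 s.+2| + #|links N s|],
    which in terms of [w] reads [w t.+1 k.+1 = w t.+2 k + w t k.+1] ([wSS]),
    with boundary cases [wS0] and [w0S].  Both sides of the convolution identity
    obey this recurrence, so they agree. *)

(** * Matchings of boundary positions *)

(** Monic diagrams with [t] bottom points, in boundary coordinates.  The bottom
    points occupy the positions below [t], so the last clause is monicity.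
    Decoupling [N] from [t] lets the same matching be regarded as having more or
    fewer bottom points. *)
Definition links (N t : nat) : {set {ffun 'I_N -> 'I_N}} :=
  [set f : {ffun 'I_N -> 'I_N} | [&& [forall p, (f p != p) && (f (f p) == p)],
    [forall p : 'I_N, forall q : 'I_N, ~~ [&& p < q, q < f p & f p < f q]%N]
    & [forall p : 'I_N, (p < t)%N ==> (t <= f p)%N]]].

Lemma linksP (N t : nat) (f : {ffun 'I_N -> 'I_N}) :
  reflect [/\ forall p, f p != p, forall p, f (f p) = p,
              forall p q : 'I_N, ~ [/\ p < q, q < f p & f p < f q]%N
            & forall p : 'I_N, (p < t)%N -> (t <= f p)%N]
          (f \in links N t).
Proof.
rewrite inE; apply: (iffP and3P) => [[/forallP m /forallP x /forallP u]|].
  split=> [p|p|p q [lt1 lt2 lt3]|p]; last exact/implyP.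
  - by case/andP: (m p).
  - by case/andP: (m p) => _ /eqP.
  - by move: (forallP (x p) q); rewrite lt1 lt2 lt3.
move=> [m1 m2 x u]; split; apply/forallP=> p; last by apply/implyP/u.
  by rewrite m1 m2 eqxx.
by apply/forallP=> q; apply/negP=> /and3P h; apply: (x p q).
Qed.

Section Boundary.
Variables t n : nat.

Definition position (p : point t n) : 'I_(t + n) :=
  match p with inl i => lshift n i | inr j => rshift t (rev_ord j) end.

Definition point_at (k : 'I_(t + n)) : point t n :=
  match split k with inl i => inl i | inr j => inr (rev_ord j) end.

Lemma val_position p : position p = pos p :> nat.
Proof. by case: p. Qed.

Lemma positionK : cancel position point_at.
Proof.
case=> i; rewrite /point_at /position.
  by rewrite -[lshift n i]/(unsplit (inl i)) unsplitK.
by rewrite -[rshift t _]/(unsplit (inr (rev_ord i))) unsplitK rev_ordK.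
Qed.

Lemma point_atK : cancel point_at position.
Proof.
move=> k; rewrite /point_at; case: splitP => j def_k; apply/val_inj => //=.
by rewrite def_k; have := ltn_ord j; lia.
Qed.

Definition boundary_matching (d : TL_diagram t n) :
  {ffun 'I_(t + n) -> 'I_(t + n)} :=
  [ffun k => position (val d (point_at k))].

Lemma boundary_matching_inj : injective boundary_matching.
Proof.
move=> d1 d2 /ffunP eq_d; apply/val_inj/ffunP=> p.
have := eq_d (position p); rewrite !ffunE positionK.
exact: (can_inj positionK).
Qed.

Lemma top_pointP (p : point t n) :
  reflect (exists j, p = inr j) (t <= position p)%N.
Proof.
case: p => [i|j] /=; last by rewrite leq_addr; apply: ReflectT; exists j.
by rewrite leqNgt ltn_ord; apply: ReflectF => -[].
Qed.

(** [position] is a bijection that computes [pos], so conjugation by it carries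
    each of the conditions on a diagram to the corresponding one on positions. *)
Lemma boundary_matching_image :
  boundary_matching @: [set d : TL_diagram t n | Defs.monic d] = links (t + n) t.
Proof.
apply/setP=> f; apply/imsetP/linksP => [[d]|[f1 f2 f3 f4]].
  rewrite inE => /forallP mon_d ->; case: d mon_d => d /= dP mon_d.
  case/andP: (dP) => /forallP pm_d /forallP nc_d; rewrite /boundary_matching /=.
  split=> [p|p|p q|p lt_pt]; rewrite ?ffunE.
  - rewrite (can2_eq positionK point_atK).
    by case/andP: (pm_d (point_at p)).
  - rewrite positionK; case/andP: (pm_d (point_at p)) => _ /eqP->.
    exact: point_atK.
  - rewrite -{1}(point_atK p) -{1 2}(point_atK q) !val_position => /and3P h.
    by move: (forallP (nc_d (point_at p)) (point_at q)); rewrite h.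
  - have -> : point_at p = inl (Ordinal lt_pt).
      by apply: (can_inj positionK); rewrite point_atK; apply/val_inj.
    apply/top_pointP; case/existsP: (mon_d (Ordinal lt_pt)) => j /eqP.
    by exists j.
pose d0 := [ffun p : point t n => point_at (f (position p))].
have dP : perfect_matching d0 && non_crossing d0.
  apply/andP; split; apply/forallP=> p; rewrite ?ffunE.
    by rewrite point_atK f2 positionK (can2_eq point_atK positionK) f1 eqxx.
  apply/forallP=> q; rewrite !ffunE -!val_position !point_atK.
  by apply/negP=> /and3P; apply: f3.
exists (exist _ d0 dP); last by apply/ffunP=> k; rewrite !ffunE !point_atK.
rewrite inE; apply/forallP=> i /=.
have /f4 : (position (inl i) < t)%N by rewrite /= ltn_ord.
rewrite -[f _]point_atK => /top_pointP[j def_j].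
by apply/existsP; exists j; rewrite ffunE def_j.
Qed.

End Boundary.

Lemma w_links (t k : nat) : w t k = #|links (t + (t + 2 * k)) t|.
Proof.
by rewrite -boundary_matching_image card_imset //; apply: boundary_matching_inj.
Qed.

(** * Removing an arc between neighbours *)

Section Insertion.
Variables (N s : nat) (le_sN : (s <= N)%N).

(* The new arc joins [a = s] to [a' = s.+1]; [e] is the increasing bijection
   from the N old positions onto the remaining ones. *)
Let a : 'I_N.+2 := inord s.
Let b : 'I_N.+1 := inord s.
Let a' : 'I_N.+2 := lift a b.
Let e (i : 'I_N) : 'I_N.+2 := lift a (lift b i).

Let val_a : a = s :> nat. Proof. by rewrite inordK //; lia. Qed.
Let val_b : b = s :> nat. Proof. by rewrite inordK //; lia. Qed.
Let val_a' : a' = s.+1 :> nat.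
Proof. by rewrite /= /bump val_a val_b leqnn. Qed.
Let neq_a'a : (a' == a) = false.
Proof. by apply/eqP=> /(congr1 val); rewrite /= [LHS]val_a' val_a; lia. Qed.
Let val_e i : e i = (if (i < s)%N then i : nat else i.+2) :> nat.
Proof. by rewrite /= /bump val_a val_b; case: ltnP => h; lia. Qed.

Let e_lt i j : (e i < e j)%N = (i < j)%N.
Proof. by rewrite !val_e; repeat case: ifP; lia. Qed.
Let e_inj : injective e.
Proof. by move=> i j /lift_inj/lift_inj. Qed.

Variant position_spec : 'I_N.+2 -> Prop :=
  | PositionLeft : position_spec a
  | PositionRight : position_spec a'
  | PositionOld k : position_spec (e k).

Let position_cases i : position_spec i.
Proof.
by case: (unliftP a i) => [j|] ->; first case: (unliftP b j) => [k|] ->;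
  constructor.
Qed.

Let old (i : 'I_N.+2) : option 'I_N := obind (unlift b) (unlift a i).

Let old_a : old a = None. Proof. by rewrite /old unlift_none. Qed.
Let old_a' : old a' = None. Proof. by rewrite /old liftK /= unlift_none. Qed.
Let old_e k : old (e k) = Some k. Proof. by rewrite /old liftK /= liftK. Qed.

Definition insert_arc (g : {ffun 'I_N -> 'I_N}) : {ffun 'I_N.+2 -> 'I_N.+2} :=
  [ffun i => if old i is Some k then e (g k) else if i == a then a' else a].

(** The default [i] is reached only if some old position is matched with an end
    of the arc, hence never when [f] joins the two ends to each other. *)
Definition remove_arc (f : {ffun 'I_N.+2 -> 'I_N.+2}) : {ffun 'I_N -> 'I_N} :=
  [ffun i => odflt i (old (f (e i)))].

Let insert_a g : insert_arc g a = a'.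
Proof. by rewrite ffunE old_a eqxx. Qed.
Let insert_a' g : insert_arc g a' = a.
Proof. by rewrite ffunE old_a' neq_a'a. Qed.
Let insert_e g k : insert_arc g (e k) = e (g k).
Proof. by rewrite ffunE old_e. Qed.

Lemma insert_arc_inj : injective insert_arc.
Proof.
move=> g1 g2 /ffunP eq_g; apply/ffunP=> k.
by apply: e_inj; rewrite -!insert_e eq_g.
Qed.

(** An arc between neighbours has no room for a crossing, and its left end
    becomes the extra bottom point. *)
Lemma insert_arc_links g :
  g \in links N s -> insert_arc g \in links N.+2 s.+1.
Proof.
case/linksP=> g1 g2 g3 g4; apply/linksP; split=> [p|p|p q|p].
- case: (position_cases p) => [||k]; rewrite ?insert_a ?insert_a' ?insert_e.
  + by rewrite neq_a'a.
  + by rewrite eq_sym neq_a'a.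
  + by rewrite (inj_eq e_inj).
- case: (position_cases p) => [||k];
    by rewrite ?(insert_a, insert_a', insert_e) // g2.
- case: (position_cases p) => [||k]; rewrite ?insert_a ?insert_a' ?insert_e.
  + by rewrite val_a val_a' => -[]; lia.
  + by rewrite val_a val_a' => -[]; lia.
  case: (position_cases q) => [||l]; rewrite ?insert_a ?insert_a' ?insert_e.
  + by rewrite val_a val_a' !val_e => -[]; repeat case: ifP; lia.
  + by rewrite val_a val_a' !val_e => -[]; repeat case: ifP; lia.
  by rewrite !e_lt; apply: g3.
- case: (position_cases p) => [||k];
  rewrite ?insert_a ?insert_a' ?insert_e ?val_a ?val_a' ?val_e; try lia.
  by have := g4 k; repeat case: ifP; lia.
Qed.

(** If [f a'] were further left than [a], then [a] would lie under the arc from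
    [f a'] to [a']; by monicity the partner of [a] is not below [s.+1], so it is
    beyond [a'] and the two arcs cross. *)
Lemma innermost_arc (f : {ffun 'I_N.+2 -> 'I_N.+2}) :
  f \in links N.+2 s.+1 -> (f a' < s.+1)%N -> f a' = a.
Proof.
case/linksP=> f1 f2 f3 f4 lt_fa'; apply/ord_inj; rewrite val_a.
have := f4 a; rewrite val_a => /(_ (ltnSn s)) le_fa.
case: (ltngtP (f a') s) => [lt_s||//]; last by lia.
case: (@f3 (f a') a); rewrite f2 val_a val_a'; split=> //.
rewrite ltn_neqAle le_fa andbT -val_a' (inj_eq val_inj).
by apply: contraTneq lt_s => ->; rewrite f2 val_a ltnn.
Qed.

Lemma remove_arcK f :
  f \in links N.+2 s.+1 -> f a' = a -> insert_arc (remove_arc f) = f.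
Proof.
case/linksP=> f1 f2 f3 f4 fa'; have fa : f a = a' by rewrite -fa' f2.
apply/ffunP=> p; case: (position_cases p) => [||k].
- by rewrite insert_a fa.
- by rewrite insert_a' fa'.
rewrite insert_e ffunE; case def_fe: (f (e k)) / (position_cases _) => [||l].
- have := congr1 f def_fe; rewrite f2 fa => /(congr1 old).
  by rewrite old_e old_a'.
- have := congr1 f def_fe; rewrite f2 fa' => /(congr1 old).
  by rewrite old_e old_a.
- by rewrite old_e.
Qed.

Lemma insert_arc_links_inv g :
  insert_arc g \in links N.+2 s.+1 -> g \in links N s.
Proof.
case/linksP=> f1 f2 f3 f4; apply/linksP; split=> [p|p|p q [lt1 lt2 lt3]|p lt_ps].
- by have := f1 (e p); rewrite insert_e (inj_eq e_inj).
- by apply: e_inj; rewrite -!insert_e f2.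
- by case: (f3 (e p) (e q)); rewrite !insert_e !e_lt.
- have := f4 (e p); rewrite insert_e !val_e lt_ps => /(_ (ltnW lt_ps)).
  by case: ifP; lia.
Qed.

Lemma card_links_closed (p : 'I_N.+2) : p = s.+1 :> nat ->
  #|[set f in links N.+2 s.+1 | (f p < s.+1)%N]| = #|links N s|.
Proof.
move=> def_p; have {p def_p}-> : p = a' by apply/ord_inj; rewrite val_a'.
rewrite -(card_imset _ insert_arc_inj); apply: eq_card => f.
rewrite inE; apply/andP/imsetP => [[fP /(innermost_arc fP) fa']|[g gP ->]].
  have fK := remove_arcK fP fa'; exists (remove_arc f) => //.
  by apply: insert_arc_links_inv; rewrite fK.
by rewrite insert_arc_links // insert_a' val_a.
Qed.

End Insertion.

(** * Counting *)

(** A position whose partner lies to its right can be added to the first [t]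
    ones: their partners are not below [t], and none of them is [t] itself. *)
Lemma card_links_split N t (p : 'I_N) : p = t :> nat ->
  #|links N t| = (#|links N t.+1| + #|[set f in links N t | (f p < t)%N]|)%N.
Proof.
move=> def_p; rewrite -(cardsID [set f : {ffun 'I_N -> 'I_N} | (t <= f p)%N]).
congr (_ + _)%N.
  apply: eq_card => f; rewrite in_setI [X in _ && X]inE.
  apply/andP/idP => [[/linksP[f1 f2 f3 f4] le_t]|/linksP[f1 f2 f3 f4]].
    apply/linksP; split=> // q; rewrite ltnS leq_eqVlt => /predU1P[eq_q|lt_q].
      have -> : q = p by apply/ord_inj; rewrite eq_q def_p.
      by have := f1 p; rewrite -(inj_eq (@ord_inj N)) def_p; lia.
    rewrite ltn_neqAle f4 // andbT -def_p (inj_eq val_inj).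
    by apply: contraTneq le_t => ->; rewrite f2 -ltnNge.
  have := f4 p; rewrite def_p => /(_ (ltnSn t)) lt_t; split; last exact: ltnW.
  by apply/linksP; split=> // q lt_q; apply/ltnW/f4/ltnW.
by apply: eq_card => f; rewrite !inE -ltnNge andbC.
Qed.

Lemma card_links0 n : #|links n.+1 0| = #|links n.+1 1|.
Proof.
rewrite (@card_links_split _ _ ord0) //.
rewrite (_ : [set f in _ | _] = set0) ?cards0 ?addn0 //.
by apply/setP=> f; rewrite !inE andbF.
Qed.

(** The bound on [s] puts the position [s.+1] inside the range. *)
Lemma card_linksS N s : (s <= N)%N ->
  #|links N.+2 s.+1| = (#|links N.+2 s.+2| + #|links N s|)%N.
Proof.
move=> le_sN; have lt_s : (s.+1 < N.+2)%N by [].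
rewrite (@card_links_split _ _ (Ordinal lt_s)) //.
by rewrite (@card_links_closed N s le_sN (Ordinal lt_s)).
Qed.

(** There are not enough top points for all the bottom points. *)
Lemma card_links_small n t : (n < t)%N -> #|links (t + n) t| = 0%N.
Proof.
elim: n t => [|n IHn] [//|t] lt_nt.
  rewrite addn0; apply: eq_card0 => f; apply/negP=> /linksP[_ _ _ f4].
  by have := f4 ord0 isT; rewrite leqNgt ltn_ord.
rewrite addSn addnS card_linksS ?leq_addr // IHn //.
by rewrite (_ : (t + n).+2 = t.+2 + n)%N // IHn //; lia.
Qed.

(* The unique function on no positions is the empty diagram. *)
Lemma w00 : w 0 0 = 1%N.
Proof.
rewrite w_links; apply/eqP/cards1P; exists [ffun i => i].
apply/setP=> f; rewrite inE; apply/linksP/eqP => [_|_].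
  by apply/ffunP => -[].
by split=> -[].
Qed.

(** Here the first summand of [card_linksS] would count diagrams with fewer top
    points than bottom points. *)
Lemma wS0 t : w t.+1 0 = w t 0.
Proof.
rewrite !w_links muln0 !addn0 addSn addnS card_linksS ?leq_addr //.
by rewrite (_ : (t + t).+2 = t.+2 + t)%N // card_links_small //; lia.
Qed.

(** Bending the first boundary position down: without bottom points, its
    partner is necessarily to its right. *)
Lemma w0S k : w 0 k.+1 = w 1 k.
Proof. by rewrite !w_links !add0n mulnS card_links0. Qed.

(** The bend in [card_linksS] trades a top point for a bottom point, which
    raises [t] by one and lowers [k] by one. *)
Lemma wSS t k : w t.+1 k.+1 = (w t.+2 k + w t k.+1)%N.
Proof.
rewrite !w_links; have le_t : (t <= t + (t + 2 * k.+1))%N by exact: leq_addr.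
rewrite (_ : t.+1 + _ = (t + (t + 2 * k.+1)).+2)%N; last by lia.
by rewrite card_linksS //; congr (#|links _ _| + _)%N; lia.
Qed.

Lemma wt0 t : w t 0 = 1%N.
Proof. by elim: t => [|t IHt]; rewrite ?w00 // wS0. Qed.

(** The induction expands the factor [w a (k - i)], which is why a general [a]
    is needed for the case [a = 0]: [w0S] turns [w 0] into [w 1], and [wSS]
    turns [w a.+1] into [w a.+2] and [w a].  The term [i = k.+1] is set apart,
    its second factor being [w a 0 = 1]. *)
Lemma w_convolution (t a k : nat) :
  w (t + a).+1 k = (\sum_(i < k.+1) w t i * w a (k - i))%N.
Proof.
elim: k t a => [|k IHk] t a; first by rewrite big_ord1 subnn !wt0.
elim: a => [|a IHa].
  rewrite addn0 wSS big_ord_recr /= subnn wt0 muln1; congr (_ + _)%N.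
  rewrite -[in LHS](addn1 t) IHk; apply: eq_bigr => i _.
  by rewrite subSn -1?ltnS // w0S.
have IHk2 := IHk t a.+2; rewrite !addnS in IHk2.
rewrite addnS wSS IHa big_ord_recr [in RHS]big_ord_recr /= IHk2 !subnn !wt0 addnA.
congr (_ + _)%N; rewrite -big_split /=; apply: eq_bigr => i _.
by rewrite subSn -1?ltnS // wSS mulnDr.
Qed.

Theorem corollary4p6 : Wxy = cx / (1 - y * cx).
Proof.
apply: (canRL (mulrK denominator_unit)); rewrite mulrBr mulr1 mulrCA; apply/fpsP=> t; rewrite coef_fpsB coef_fpsXM.
case: t => [|t]; first by rewrite subr0.
rewrite coef_fpsM big_ord_recr /= subnn big1 ?add0r => [|i _]; last first.
  by rewrite subn_eq0 leqNgt ltn_ord mulr0.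
apply/eqP; rewrite subr_eq0; apply/eqP/fpsP=> k.
rewrite coef_fpsM /= -[in LHS](addn0 t) w_convolution -natz natr_sum.
by apply: eq_bigr => i _; rewrite natrM !natz.
Qed.
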